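(* Let $\beta: I\to M\subset G^3$ be a unit-speed curve on a surface $M$ in the Galilean space $G^3$ which is a line of curvature ($\tau_g\equiv0$), with geodesic curvature $\kappa_g$ and normal curvature $\kappa_n$. Then there are real constants $c_1,c_2,c_3,c_4$ such that, for a suitable choice of antiderivatives, $$\beta(x)=\Bigg(x,\ \int\!\!\int\big(c_1\kappa_g(x)-c_2\kappa_n(x)\big)dx\,dx,\ \int\!\!\int\big(c_3\kappa_g(x)-c_4\kappa_n(x)\big)dx\,dx\Bigg).$$
   Context: The Galilean space $G^3$ is $\mathbb R^3$ with the scalar product $\mathbf v\cdot_G\mathbf w=v_1w_1$ if $v_1\ne0$ or $w_1\neq 0$, and $\mathbf v\cdot_G\mathbf w=v_2w_2+v_3w_3$ if $v_1=w_1=0$; the norm is $\|\mathbf v\|_G=\sqrt{|\mathbf v\cdot_G\mathbf v|}$ and the cross product is $\mathbf v\times_G\mathbf w=(0,\,v_3w_1-v_1w_3,\,v_1w_2-v_2w_1)$. A vector is isotropic if its first component is $0$. All objects are smooth and $I\subset\mathbb R$ is an open interval. $M$ is an oriented surface with local parametrizations $\phi(u,v)$ such that the first components of $\phi_u,\phi_v$ are not both zero; its unit normal is the isotropic vector field $\mathbf n=\pm\,\phi_u\times_G\phi_v/\|\phi_u\times_G\phi_v\|_G$ (sign fixed by the orientation). A unit-speed curve (parametrized by arc length) is one of the form $\beta(x)=(x,y(x),z(x))$, $x\in I$. Its Darboux frame with respect to $M$ is $\{\mathbf T,\mathbf Q,\mathbf n\}$ with $\mathbf T=\beta'$, $\mathbf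 n$ the unit normal of $M$ along $\beta$, and $\mathbf Q=\mathbf T\times_G\mathbf n$. The functions $\kappa_g=\mathbf T'\cdot_G\mathbf Q$, $\kappa_n=\mathbf T'\cdot_G\mathbf n$, $\tau_g=\mathbf Q'\cdot_G\mathbf n$ are the geodesic curvature, normal curvature and geodesic torsion; equivalently $\mathbf T'=\kappa_g\mathbf Q+\kappa_n\mathbf n$, $\mathbf Q'=\tau_g\mathbf n$, $\mathbf n'=-\tau_g\mathbf Q$. The symbol $\int g(x)\,dx$ denotes an antiderivative of $g$ on $I$. *)

(* Defs.v *)
From Stdlib Require Import Reals.
From Coquelicot Require Import Coquelicot.
Open Scope R_scope.

Definition G3 : Type := (R * R * R)%type.

Definition px (v : G3) : R := fst (fst v).
Definition py (v : G3) : R := snd (fst v).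
Definition pz (v : G3) : R := snd v.

Definition gdot (v w : G3) : R :=
  if Req_EM_T (px v) 0 then
    if Req_EM_T (px w) 0 then py v * py w + pz v * pz w
    else px v * px w
  else px v * px w.

Definition gnorm (v : G3) : R := sqrt (Rabs (gdot v v)).

Definition gcross (v w : G3) : G3 :=
  (0, pz v * px w - px v * pz w, px v * py w - py v * px w).

Definition smul (a : R) (v : G3) : G3 := (a * px v, a * py v, a * pz v).

Definition lin_indep (v w : G3) : Prop :=
  forall a b : R,
    a * px v + b * px w = 0 -> a * py v + b * py w = 0 ->
    a * pz v + b * pz w = 0 -> a = 0 /\ b = 0.

(** [Derive] is total; below it is applied to smooth data only (for
    the normal along a curve, smoothness follows from that of the curve and
    of the local parametrizations). *)
Definition vDerive (f : R -> G3) (x : R) : G3 :=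
  (Derive (fun t => px (f t)) x, Derive (fun t => py (f t)) x,
   Derive (fun t => pz (f t)) x).

(** The open interval (a,b), possibly unbounded. *)
Definition Rbar_Ioo (a b : Rbar) (x : R) : Prop :=
  Rbar_lt a x /\ Rbar_lt x b.

Definition smooth_curve_on (I : R -> Prop) (f : R -> G3) : Prop :=
  forall x, I x -> forall k : nat,
    ex_derive_n (fun t => px (f t)) k x /\
    ex_derive_n (fun t => py (f t)) k x /\
    ex_derive_n (fun t => pz (f t)) k x.

Definition unit_speed_on (I : R -> Prop) (beta : R -> G3) : Prop :=
  forall x, I x -> px (beta x) = x.

Definition antiderivative_on (I : R -> Prop) (F f : R -> R) : Prop :=
  forall x, I x -> is_derive F x (f x).

Definition D_u (phi : R -> R -> G3) (u v : R) : G3 :=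
  vDerive (fun t => phi t v) u.
Definition D_v (phi : R -> R -> G3) (u v : R) : G3 :=
  vDerive (fun t => phi u t) v.

(** [ex_diff_n f k u v] for all [k] at all points of an open set says that
    [f] has continuous partial derivatives of all orders there. *)
Definition smooth_map_on (U : R * R -> Prop) (phi : R -> R -> G3) : Prop :=
  forall u v, U (u, v) -> forall k : nat,
    ex_diff_n (fun s t => px (phi s t)) k u v /\
    ex_diff_n (fun s t => py (phi s t)) k u v /\
    ex_diff_n (fun s t => pz (phi s t)) k u v.

(** A local parametrization of [M]: a smooth immersion [phi] of an open
    [U] that is a homeomorphism onto the relatively open subset [M /\ O] of
    [M] (with inverse [psi]), no tangent plane consisting of isotropic
    vectors. *)
Record local_param (M : G3 -> Prop) (U : R * R -> Prop)
    (phi : R -> R -> G3) : Prop := {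
  param_open : open U;
  param_smooth : smooth_map_on U phi;
  param_immersion : forall u v, U (u, v) ->
    lin_indep (D_u phi u v) (D_v phi u v);
  param_admissible : forall u v, U (u, v) ->
    ~ (px (D_u phi u v) = 0 /\ px (D_v phi u v) = 0);
  param_homeo : exists (O : R * R * R -> Prop) (psi : R * R * R -> R * R),
    open O /\
    (forall p, (M p /\ O p) <-> exists u v, U (u, v) /\ phi u v = p) /\
    (forall u v, U (u, v) -> psi (phi u v) = (u, v)) /\
    continuous_on (fun p => M p /\ O p) psi
}.

Definition param_normal (phi : R -> R -> G3) (u v : R) : G3 :=
  let w := gcross (D_u phi u v) (D_v phi u v) in smul (/ gnorm w) w.

(** [M] is a surface, oriented by the unit normal field [n]: around every
    point there is a local parametrization on which [n] is
    [phi_u x phi_v / ||phi_u x phi_v||] up to one constant sign [s]. *)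
Definition oriented_surface (M : G3 -> Prop) (n : G3 -> G3) : Prop :=
  forall p, M p -> exists (U : R * R -> Prop) (phi : R -> R -> G3) (s : R),
    local_param M U phi /\
    (exists u v, U (u, v) /\ phi u v = p) /\
    (s = 1 \/ s = -1) /\
    (forall u v, U (u, v) -> n (phi u v) = smul s (param_normal phi u v)).

Definition frame_T (beta : R -> G3) : R -> G3 := vDerive beta.
Definition frame_n (n : G3 -> G3) (beta : R -> G3) (x : R) : G3 := n (beta x).
Definition frame_Q (n : G3 -> G3) (beta : R -> G3) (x : R) : G3 :=
  gcross (frame_T beta x) (frame_n n beta x).

Definition geodesic_curvature (n : G3 -> G3) (beta : R -> G3) (x : R) : R :=
  gdot (vDerive (frame_T beta) x) (frame_Q n beta x).
Definition normal_curvature (n : G3 -> G3) (beta : R -> G3) (x : R) : R :=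
  gdot (vDerive (frame_T beta) x) (frame_n n beta x).
Definition geodesic_torsion (n : G3 -> G3) (beta : R -> G3) (x : R) : R :=
  gdot (vDerive (frame_Q n beta) x) (frame_n n beta x).

Definition line_of_curvature_on (I : R -> Prop) (n : G3 -> G3)
    (beta : R -> G3) : Prop :=
  forall x, I x -> geodesic_torsion n beta x = 0.

(* Main.v *)
(** Along the curve the unit normal is [(0, n2, n3)] with [n2^2 + n3^2 = 1], and
    vanishing geodesic torsion says that [(n2', n3')] is also orthogonal to
    [(- n3, n2)]; hence [n2] and [n3] are constant.  Resolving the acceleration
    [(0, y'', z'')] in the frame [Q = (0, - n3, n2)], [n = (0, n2, n3)] then gives
    [y'' = - n3 kappa_g + n2 kappa_n] and [z'' = n2 kappa_g + n3 kappa_n].  The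
    delicate point is that the normal is differentiable along the curve, which
    requires that the chart coordinates of the curve be differentiable. *)

Require Import Defs.
From Stdlib Require Import Reals Lra.
From Coquelicot Require Import Coquelicot.
Open Scope R_scope.

(** * Total differentiability in the plane and inversion of coordinates along a curve *)

(** A first partial that exists near the point and is continuous there, together with the second
    partial at the point, gives total differentiability; openness of [U] supplies the
    neighbourhood. *)
Lemma ex_diff1_differentiable_pt_lim (U : R * R -> Prop) (f : R -> R -> R) :
  open U -> (forall u v, U (u, v) -> ex_diff_n f 1 u v) ->
  forall u v, U (u, v) ->
  differentiable_pt_lim f u v (Derive (fun s => f s v) u) (Derive (f u) v).
Proof.
intros HU Hf u v Huv.
apply filterdiff_differentiable_pt_lim.
apply (is_derive_filterdiff f u v (fun s t => Derive (fun z => f z t) s)).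
- apply (filter_imp U).
  + intros [s t] Hst.
    apply Derive_correct, (proj1 (proj2 (Hf s t Hst))).
  + exact (HU _ Huv).
- apply Derive_correct, (proj1 (proj2 (proj2 (Hf u v Huv)))).
- apply (continuity_2d_pt_filterlim (fun s t => Derive (fun z => f z t) s)).
  apply (proj1 (proj1 (proj2 (proj2 (proj2 (Hf u v Huv)))))).
Qed.

(** The little-o form in which the estimates on chart coordinates are carried out. *)
Lemma is_derive_locally_iff (f : R -> R) (x l : R) :
  is_derive f x l <->
  forall eps : posreal,
    locally x (fun y => Rabs (f y - f x - l * (y - x)) <= eps * Rabs (y - x)).
Proof.
split.
- intros [_ H] eps.
  generalize (H x (fun P HP => HP) eps).
  apply filter_imp; intros y Hy.
  rewrite (Rmult_comm l). exact Hy.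
- intros H; split.
  + apply is_linear_scal_l.
  + intros x' Hx' eps.
    rewrite <- (is_filter_lim_locally_unique _ _ Hx').
    generalize (H eps); apply filter_imp; intros y Hy.
    rewrite (Rmult_comm l) in Hy. exact Hy.
Qed.

Lemma continuous_locally_2d (u v : R -> R) (x : R) (P : R -> R -> Prop) :
  continuous u x -> continuous v x -> locally_2d P (u x) (v x) ->
  locally x (fun y => P (u y) (v y)).
Proof.
intros Hu Hv [d Hd].
generalize (filter_and _ _ (proj1 (filterlim_locally _ _) Hu d)
                           (proj1 (filterlim_locally _ _) Hv d)).
apply filter_imp; intros y [Hy1 Hy2].
apply Hd; assumption.
Qed.

(** Meant for the numerators of Cramer's rule, with [r] and [s] the errors of the two equations. *)
Lemma Rabs_comb2_le (p q r s e : R) :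
  Rabs r <= e -> Rabs s <= e ->
  Rabs (p * r - q * s) <= (Rabs p + Rabs q) * e.
Proof.
intros Hr Hs.
apply Rle_trans with (1 := Rabs_triang (p * r) (- (q * s))).
rewrite Rabs_Ropp, !Rabs_mult, Rmult_plus_distr_r.
apply Rplus_le_compat; apply Rmult_le_compat_l; try apply Rabs_pos; assumption.
Qed.

Lemma Rabs_le_of_approx (p l h e : R) :
  Rabs (p - l * h) <= e -> Rabs p <= Rabs l * Rabs h + e.
Proof.
intros H; rewrite <- Rabs_mult.
generalize (Rabs_triang (p - l * h) (l * h)).
replace (p - l * h + l * h) with p by ring; lra.
Qed.

(* Solving the linearized system bounds the increment of [(u, v)] by a multiple
   of the increment of the parameter, so no inverse function theorem is needed. *)
Lemma ex_derive_inverse_coordinates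
    (f1 f2 : R -> R -> R) (u v : R -> R) (x a b c d : R) :
  differentiable_pt_lim f1 (u x) (v x) a b ->
  differentiable_pt_lim f2 (u x) (v x) c d ->
  a * d - b * c <> 0 ->
  continuous u x -> continuous v x ->
  ex_derive (fun t => f1 (u t) (v t)) x ->
  ex_derive (fun t => f2 (u t) (v t)) x ->
  ex_derive u x /\ ex_derive v x.
Proof.
intros Hf1 Hf2 HD Hu Hv [g1 Hg1] [g2 Hg2].
set (D := a * d - b * c) in *.
(* Candidate derivatives by Cramer's rule, from [a * u' + b * v' = g1] and
   [c * u' + d * v' = g2]. *)
set (u' := (d * g1 - b * g2) / D).
set (v' := (a * g2 - c * g1) / D).
set (L := Rabs u' + Rabs v').
(* [K] bounds the inverse of the linear system; the added 1 makes [1 <= K] immediate. *)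
set (K := (Rabs a + Rabs b + Rabs c + Rabs d) / Rabs D + 1).
assert (HDp : 0 < Rabs D) by now apply Rabs_pos_lt.
pose proof (Rabs_pos a); pose proof (Rabs_pos b).
pose proof (Rabs_pos c); pose proof (Rabs_pos d).
assert (HL : 0 <= L) by (apply Rplus_le_le_0_compat; apply Rabs_pos).
assert (HK : 1 <= K).
{ unfold K. assert (0 <= (Rabs a + Rabs b + Rabs c + Rabs d) / Rabs D).
  { apply Rmult_le_pos; [lra | left; now apply Rinv_0_lt_compat]. }
  lra. }
assert (HKD : Rabs a + Rabs b + Rabs c + Rabs d <= K * Rabs D).
{ unfold K. rewrite Rmult_plus_distr_r.
  replace ((Rabs a + Rabs b + Rabs c + Rabs d) / Rabs D * Rabs D)
    with (Rabs a + Rabs b + Rabs c + Rabs d) by (field; lra). lra. }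
assert (Key : forall e : posreal, K * e <= / 2 ->
  locally x (fun y =>
    Rabs (u y - u x - u' * (y - x)) <= K * e * ((2 * L + 2) * Rabs (y - x)) /\
    Rabs (v y - v x - v' * (y - x)) <= K * e * ((2 * L + 2) * Rabs (y - x)))).
{ intros e He.
  generalize (filter_and _ _
    (filter_and _ _ (continuous_locally_2d u v x _ Hu Hv (Hf1 e))
                    (continuous_locally_2d u v x _ Hu Hv (Hf2 e)))
    (filter_and _ _ (proj1 (is_derive_locally_iff _ _ _) Hg1 e)
                    (proj1 (is_derive_locally_iff _ _ _) Hg2 e))).
  apply filter_imp; intros y [[A1 A2] [A3 A4]].
  (* [m] is the increment in which the errors of [f1] and [f2] are measured; it still has to be
     controlled by [Rabs h]. *)
  set (m := Rmax (Rabs (u y - u x)) (Rabs (v y - v x))) in *.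
  set (h := y - x) in *. set (du := u y - u x) in *. set (dv := v y - v x) in *.
  (* Two first-order expansions of the same increment are compared: that of [f1] costs [e * m], that
     of the composite costs [e * Rabs h]. *)
  assert (E1 : Rabs (a * du + b * dv - g1 * h) <= e * (m + Rabs h)).
  { replace (a * du + b * dv - g1 * h) with
      (1 * (f1 (u y) (v y) - f1 (u x) (v x) - g1 * h)
       - 1 * (f1 (u y) (v y) - f1 (u x) (v x) - (a * du + b * dv))) by ring.
    rewrite !Rmult_1_l.
    generalize (Rabs_triang (f1 (u y) (v y) - f1 (u x) (v x) - g1 * h)
       (- (f1 (u y) (v y) - f1 (u x) (v x) - (a * du + b * dv)))).
    rewrite Rabs_Ropp. unfold Rminus in *. lra. }
  assert (E2 : Rabs (c * du + d * dv - g2 * h) <= e * (m + Rabs h)).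
  { generalize (Rabs_triang (f2 (u y) (v y) - f2 (u x) (v x) - g2 * h)
       (- (f2 (u y) (v y) - f2 (u x) (v x) - (c * du + d * dv)))).
    rewrite Rabs_Ropp.
    replace (f2 (u y) (v y) - f2 (u x) (v x) - g2 * h
      + - (f2 (u y) (v y) - f2 (u x) (v x) - (c * du + d * dv)))
      with (c * du + d * dv - g2 * h) by ring. lra. }
  assert (Hm : 0 <= m) by (eapply Rle_trans; [apply Rabs_pos | apply Rmax_l]).
  assert (Hem : 0 <= e * (m + Rabs h)).
  { apply Rmult_le_pos; [left; apply cond_pos | pose proof (Rabs_pos h); lra]. }
  assert (Solve : forall p q r s w w', w * D - w' * D = p * r - q * s ->
     Rabs r <= e * (m + Rabs h) -> Rabs s <= e * (m + Rabs h) ->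
     Rabs p + Rabs q <= Rabs a + Rabs b + Rabs c + Rabs d ->
     Rabs (w - w') <= K * e * (m + Rabs h)).
  { intros p q r s w w' Hw Hr Hs Hpq.
    apply Rmult_le_reg_r with (1 := HDp).
    rewrite <- Rabs_mult, Rmult_minus_distr_r, Hw.
    apply Rle_trans with (1 := Rabs_comb2_le p q r s _ Hr Hs).
    replace (K * e * (m + Rabs h) * Rabs D) with (K * Rabs D * (e * (m + Rabs h)))
      by ring.
    apply Rmult_le_compat_r; lra. }
  assert (Fu : Rabs (du - u' * h) <= K * e * (m + Rabs h)).
  { apply (Solve d b _ _ _ _) with (2 := E1) (3 := E2); [|lra].
    unfold u', D; field; exact HD. }
  assert (Fv : Rabs (dv - v' * h) <= K * e * (m + Rabs h)).
  { apply (Solve a c _ _ _ _) with (2 := E2) (3 := E1); [|lra].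
    unfold v', D; field; exact HD. }
  (* Absorption: [m] is at most [L * Rabs h] plus half of [m + Rabs h], and the half of [m] moves to
     the left-hand side. *)
  assert (Hm2 : m <= (2 * L + 1) * Rabs h).
  { pose proof (Rabs_le_of_approx _ _ _ _ Fu).
    pose proof (Rabs_le_of_approx _ _ _ _ Fv).
    pose proof (Rmult_le_pos _ _ (Rabs_pos u') (Rabs_pos h)).
    pose proof (Rmult_le_pos _ _ (Rabs_pos v') (Rabs_pos h)).
    assert (K * e * (m + Rabs h) <= / 2 * (m + Rabs h)).
    { apply Rmult_le_compat_r; [pose proof (Rabs_pos h); lra | exact He]. }
    assert (m <= L * Rabs h + K * e * (m + Rabs h)).
    { unfold L. apply Rmax_lub; lra. }
    lra. }
  assert (K * e * (m + Rabs h) <= K * e * ((2 * L + 2) * Rabs h)).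
  { apply Rmult_le_compat_l; [|lra].
    apply Rmult_le_pos; [lra | left; apply cond_pos]. }
  split; lra. }
assert (Main : forall eps : posreal, exists e : posreal, K * e <= / 2 /\
   forall h, K * e * ((2 * L + 2) * Rabs h) <= eps * Rabs h).
{ intros eps.
  (* The first bound permits the absorption, the second brings the final error below [eps]. *)
  assert (He : 0 < Rmin (/ 2 / K) (eps / (K * (2 * L + 2)))).
  { apply Rmin_glb_lt; apply Rdiv_lt_0_compat; try lra.
    - apply cond_pos.
    - apply Rmult_lt_0_compat; lra. }
  exists (mkposreal _ He); simpl; split.
  - apply Rle_trans with (K * (/ 2 / K)).
    + apply Rmult_le_compat_l; [lra | apply Rmin_l].
    + right; field; lra.
  - intros h. rewrite <- Rmult_assoc.
    apply Rmult_le_compat_r; [apply Rabs_pos |].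
    apply Rle_trans with (K * (eps / (K * (2 * L + 2))) * (2 * L + 2)).
    + apply Rmult_le_compat_r; [lra |].
      apply Rmult_le_compat_l; [lra | apply Rmin_r].
    + right; field; lra. }
split; [exists u' | exists v']; apply is_derive_locally_iff; intros eps;
  destruct (Main eps) as (e & He & Hh);
  generalize (Key e He); apply filter_imp; intros y [Hy1 Hy2];
  eapply Rle_trans; [exact Hy1 | apply Hh | exact Hy2 | apply Hh].
Qed.

Lemma ex_derive_comp_2d (U : R * R -> Prop) (f : R -> R -> R) (u v : R -> R)
    (x : R) :
  open U -> (forall s t, U (s, t) -> ex_diff_n f 1 s t) -> U (u x, v x) ->
  ex_derive u x -> ex_derive v x -> ex_derive (fun t => f (u t) (v t)) x.
Proof.
intros HU Hf Hx [lu Hu] [lv Hv].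
exists (Derive (fun s => f s (v x)) (u x) * lu + Derive (f (u x)) (v x) * lv).
apply is_derive_Reals, derivable_pt_lim_comp_2d.
- exact (ex_diff1_differentiable_pt_lim U f HU Hf _ _ Hx).
- now apply is_derive_Reals.
- now apply is_derive_Reals.
Qed.

(** * The Galilean cross product and the unit normal of a chart *)

(** If both components vanished, [px w] and [- px v] would be the coefficients of a linear relation
    between [v] and [w], so both would be zero, against admissibility. *)
Lemma gcross_neq0 (v w : G3) :
  lin_indep v w -> ~ (px v = 0 /\ px w = 0) ->
  py (gcross v w) <> 0 \/ pz (gcross v w) <> 0.
Proof.
intros Hi Ha.
destruct (Req_dec (py (gcross v w)) 0) as [Hy|Hy]; [|now left].
destruct (Req_dec (pz (gcross v w)) 0) as [Hz|Hz]; [|now right].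
exfalso; apply Ha.
unfold gcross, py, pz in Hy, Hz; simpl in Hy, Hz.
destruct (Hi (px w) (- px v)) as [H1 H2].
- ring.
- unfold px, py, pz in *; lra.
- unfold px, py, pz in *; lra.
- split; lra.
Qed.

(** A cross product is isotropic, so [gdot] takes its Euclidean branch. *)
Lemma gnorm_gcross (v w : G3) :
  gnorm (gcross v w) =
  sqrt (py (gcross v w) * py (gcross v w) + pz (gcross v w) * pz (gcross v w)).
Proof.
unfold gnorm, gdot.
destruct (Req_EM_T (px (gcross v w)) 0) as [_|H]; [|now elim H].
rewrite Rabs_pos_eq; [reflexivity|].
apply Rplus_le_le_0_compat; apply Rle_0_sqr.
Qed.

Lemma param_normal_unit (M : G3 -> Prop) (U : R * R -> Prop)
    (phi : R -> R -> G3) (u v : R) :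
  local_param M U phi -> U (u, v) ->
  px (param_normal phi u v) = 0 /\
  py (param_normal phi u v) * py (param_normal phi u v) +
  pz (param_normal phi u v) * pz (param_normal phi u v) = 1.
Proof.
intros HP Huv.
destruct (gcross_neq0 _ _ (param_immersion _ _ _ HP u v Huv)
  (param_admissible _ _ _ HP u v Huv)) as [Hw|Hw];
unfold param_normal; rewrite gnorm_gcross;
set (w := gcross _ _) in *;
(split; [unfold smul, px; simpl; ring|]);
change (py (smul ?a ?b)) with (a * py b);
change (pz (smul ?a ?b)) with (a * pz b);
assert (Hpos : 0 < py w * py w + pz w * pz w)
  by (generalize (Rle_0_sqr (py w)) (Rle_0_sqr (pz w)) (Rlt_0_sqr _ Hw);
      unfold Rsqr; lra);
pose proof (sqrt_lt_R0 _ Hpos) as Hs;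
pose proof (sqrt_sqrt _ (Rlt_le _ _ Hpos)) as Hss;
set (r := sqrt _) in *;
replace (/ r * py w * (/ r * py w) + / r * pz w * (/ r * pz w))
  with ((py w * py w + pz w * pz w) / (r * r)) by (field; lra);
rewrite Hss; field; lra.
Qed.

(** The orientation sign squares to 1 and leaves the unit length of the chart normal unchanged. *)
Lemma oriented_normal_unit (M : G3 -> Prop) (n : G3 -> G3) (p : G3) :
  oriented_surface M n -> M p ->
  px (n p) = 0 /\ py (n p) * py (n p) + pz (n p) * pz (n p) = 1.
Proof.
intros HM Hp.
destruct (HM p Hp) as (U & phi & s & HP & (u & v & Huv & <-) & Hs & Hn).
rewrite (Hn u v Huv).
destruct (param_normal_unit M U phi u v HP Huv) as [H0 H1].
change (px (smul ?a ?b)) with (a * px b).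
change (py (smul ?a ?b)) with (a * py b).
change (pz (smul ?a ?b)) with (a * pz b).
rewrite H0; split; [ring|].
destruct Hs as [-> | ->]; lra.
Qed.

(** * Differentiability of the normal along the curve *)

(** The explicit [T] selects the product uniform structure, the one in which [open O] is read in
    [local_param]. *)
Lemma continuous_triple (f : R -> G3) (x : R) :
  continuous (fun t => px (f t)) x -> continuous (fun t => py (f t)) x ->
  continuous (fun t => pz (f t)) x ->
  filterlim f (locally x) (locally (T := prod_UniformSpace (prod_UniformSpace
    R_UniformSpace R_UniformSpace) R_UniformSpace) (f x)).
Proof.
intros Hx Hy Hz.
apply filterlim_locally; intros eps.
generalize (filter_and _ _ (proj1 (filterlim_locally _ _) Hx eps)
  (filter_and _ _ (proj1 (filterlim_locally _ _) Hy eps)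
                  (proj1 (filterlim_locally _ _) Hz eps))).
apply filter_imp; intros t (H1 & H2 & H3).
repeat split; assumption.
Qed.

(* The coordinates [(u, v)] of the curve in a chart are continuous because the
   chart is a homeomorphism onto its image. *)
Lemma curve_in_chart (M : G3 -> Prop) (U : R * R -> Prop) (phi : R -> R -> G3)
    (beta : R -> G3) (x : R) :
  local_param M U phi ->
  (exists u v, U (u, v) /\ phi u v = beta x) ->
  locally x (fun t => M (beta t)) ->
  ex_derive (fun t => px (beta t)) x -> ex_derive (fun t => py (beta t)) x ->
  ex_derive (fun t => pz (beta t)) x ->
  exists u v : R -> R,
    continuous u x /\ continuous v x /\
    locally x (fun t => U (u t, v t) /\ phi (u t) (v t) = beta t).
Proof.
intros HP Hx HM Hd1 Hd2 Hd3.
destruct (param_homeo _ _ _ HP) as (O & psi & HO & Him & Hpsi & Hc).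
assert (Hb := continuous_triple beta x (ex_derive_continuous _ _ Hd1)
   (ex_derive_continuous _ _ Hd2) (ex_derive_continuous _ _ Hd3)).
destruct (proj2 (Him (beta x)) Hx) as [Mx Ox].
assert (HMO : locally x (fun t => M (beta t) /\ O (beta t))).
{ apply filter_and; [exact HM|]. exact (Hb O (HO _ Ox)). }
assert (Hcont : filterlim (fun t => psi (beta t)) (locally x)
                          (locally (psi (beta x)))).
{ intros P HPP.
  change (locally x (fun t => P (psi (beta t)))).
  generalize (filter_and _ _ HMO (Hb _ (Hc _ (conj Mx Ox) P HPP))).
  apply filter_imp; intros t [H1 H2]; exact (H2 H1). }
exists (fun t => fst (psi (beta t))), (fun t => snd (psi (beta t))).
split; [|split].
- eapply filterlim_comp; [exact Hcont|].
  destruct (psi (beta x)); apply continuous_fst.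
- eapply filterlim_comp; [exact Hcont|].
  destruct (psi (beta x)); apply continuous_snd.
- revert HMO; apply filter_imp; intros t Ht.
  destruct (proj1 (Him _) Ht) as (u & v & Huv & <-).
  now rewrite (Hpsi u v Huv).
Qed.

Lemma ex_diff_n_S_inv (f : R -> R -> R) (k : nat) (u v : R) :
  ex_diff_n f (S k) u v ->
  ex_diff_n (fun s t => Derive (fun z => f z t) s) k u v /\
  ex_diff_n (fun s t => Derive (fun z => f s z) t) k u v.
Proof. now intros (_ & _ & _ & H). Qed.

(** The components of the cross product are, up to sign, the minors of the Jacobian pairing [px]
    with [pz] and [px] with [py]. One of them is nonzero, and that pair of components is
    inverted. *)
Lemma ex_derive_coordinates (M : G3 -> Prop) (U : R * R -> Prop)
    (phi : R -> R -> G3) (u v : R -> R) (x : R) :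
  local_param M U phi -> U (u x, v x) -> continuous u x -> continuous v x ->
  ex_derive (fun t => px (phi (u t) (v t))) x ->
  ex_derive (fun t => py (phi (u t) (v t))) x ->
  ex_derive (fun t => pz (phi (u t) (v t))) x ->
  ex_derive u x /\ ex_derive v x.
Proof.
intros HP Hx Hu Hv H1 H2 H3.
pose proof (param_open _ _ _ HP) as HU.
pose proof (param_smooth _ _ _ HP) as Hsm.
pose proof (ex_diff1_differentiable_pt_lim U (fun s t => px (phi s t)) HU
  (fun s t H => proj1 (Hsm s t H 1%nat)) _ _ Hx) as D1.
pose proof (ex_diff1_differentiable_pt_lim U (fun s t => py (phi s t)) HU
  (fun s t H => proj1 (proj2 (Hsm s t H 1%nat))) _ _ Hx) as D2.
pose proof (ex_diff1_differentiable_pt_lim U (fun s t => pz (phi s t)) HU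
  (fun s t H => proj2 (proj2 (Hsm s t H 1%nat))) _ _ Hx) as D3.
destruct (gcross_neq0 _ _ (param_immersion _ _ _ HP _ _ Hx)
  (param_admissible _ _ _ HP _ _ Hx)) as [Hw|Hw];
unfold gcross, D_u, D_v, vDerive, px, py, pz in *; simpl in *.
- apply (ex_derive_inverse_coordinates _ _ u v x _ _ _ _ D1 D3); trivial.
  intros E; apply Hw; lra.
- apply (ex_derive_inverse_coordinates _ _ u v x _ _ _ _ D1 D2); trivial.
  intros E; apply Hw; lra.
Qed.

Lemma ex_derive_inv_sqrt (f : R -> R) (x : R) :
  ex_derive f x -> 0 < f x -> ex_derive (fun t => / sqrt (f t)) x.
Proof.
intros Hf Hpos; auto_derive; repeat split; trivial.
now apply Rgt_not_eq, sqrt_lt_R0.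
Qed.

(** Along the curve, [n] is a fixed sign times the normalized cross product of the partials of [phi]
    at differentiable chart coordinates, so the chain rule applies. *)
Lemma ex_derive_normal_along (M : G3 -> Prop) (n : G3 -> G3) (beta : R -> G3)
    (x : R) :
  oriented_surface M n -> locally x (fun t => M (beta t)) ->
  ex_derive (fun t => px (beta t)) x -> ex_derive (fun t => py (beta t)) x ->
  ex_derive (fun t => pz (beta t)) x ->
  ex_derive (fun t => py (n (beta t))) x /\
  ex_derive (fun t => pz (n (beta t))) x.
Proof.
intros HO HM H1 H2 H3.
destruct (HO _ (locally_singleton _ _ HM)) as (U & phi & s & HP & Hx & _ & Hn).
destruct (curve_in_chart M U phi beta x HP Hx HM H1 H2 H3)
  as (u & v & Hu & Hv & Huv).
destruct (locally_singleton _ _ Huv) as [HUx _].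
assert (Hext : forall g : G3 -> R,
  locally x (fun t => g (beta t) = g (phi (u t) (v t)))).
{ intros g; revert Huv; apply filter_imp; intros t [_ E]; now rewrite E. }
destruct (ex_derive_coordinates M U phi u v x HP HUx Hu Hv
  (ex_derive_ext_loc _ _ _ (Hext px) H1) (ex_derive_ext_loc _ _ _ (Hext py) H2)
  (ex_derive_ext_loc _ _ _ (Hext pz) H3)) as [Du Dv].
pose proof (param_open _ _ _ HP) as HU.
pose proof (param_smooth _ _ _ HP) as Hsm.
(* Order 2 is required because the functions composed with the curve are first partials, which must
   themselves be differentiable. *)
assert (Hpart : forall f : R -> R -> R,
  (forall a b, U (a, b) -> ex_diff_n f 2 a b) ->
  ex_derive (fun t => Derive (fun z => f z (v t)) (u t)) x /\
  ex_derive (fun t => Derive (fun z => f (u t) z) (v t)) x).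
{ intros f Hf; split.
  - apply (ex_derive_comp_2d U (fun a b => Derive (fun z => f z b) a));
      trivial.
    intros a b Hab; exact (proj1 (ex_diff_n_S_inv f 1 a b (Hf a b Hab))).
  - apply (ex_derive_comp_2d U (fun a b => Derive (fun z => f a z) b));
      trivial.
    intros a b Hab; exact (proj2 (ex_diff_n_S_inv f 1 a b (Hf a b Hab))). }
destruct (Hpart (fun a b => px (phi a b))) as [Xu Xv].
{ intros a b H; apply (Hsm a b H 2%nat). }
destruct (Hpart (fun a b => py (phi a b))) as [Yu Yv].
{ intros a b H; apply (Hsm a b H 2%nat). }
destruct (Hpart (fun a b => pz (phi a b))) as [Zu Zv].
{ intros a b H; apply (Hsm a b H 2%nat). }
set (w := fun t => gcross (D_u phi (u t) (v t)) (D_v phi (u t) (v t))).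
assert (Wy : ex_derive (fun t => py (w t)) x).
{ unfold w, gcross, py; simpl.
  apply (ex_derive_minus (V := R_NormedModule)); now apply ex_derive_mult. }
assert (Wz : ex_derive (fun t => pz (w t)) x).
{ unfold w, gcross, pz; simpl.
  apply (ex_derive_minus (V := R_NormedModule)); now apply ex_derive_mult. }
assert (Hpos : 0 < py (w x) * py (w x) + pz (w x) * pz (w x)).
{ destruct (gcross_neq0 _ _ (param_immersion _ _ _ HP _ _ HUx)
    (param_admissible _ _ _ HP _ _ HUx)) as [Hw|Hw];
  fold (w x) in Hw;
  generalize (Rle_0_sqr (py (w x))) (Rle_0_sqr (pz (w x))) (Rlt_0_sqr _ Hw);
  unfold Rsqr; lra. }
assert (Hnorm : ex_derive
  (fun t => / sqrt (py (w t) * py (w t) + pz (w t) * pz (w t))) x).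
{ apply (ex_derive_inv_sqrt (fun t => py (w t) * py (w t) + pz (w t) * pz (w t)));
    [|exact Hpos].
  apply (ex_derive_plus (V := R_NormedModule)); now apply ex_derive_mult. }
assert (Hnb : locally x (fun t => smul s (smul
   (/ sqrt (py (w t) * py (w t) + pz (w t) * pz (w t))) (w t)) = n (beta t))).
{ revert Huv; apply filter_imp; intros t [HUt <-].
  rewrite (Hn _ _ HUt). unfold param_normal; now rewrite gnorm_gcross. }
split.
- apply (ex_derive_ext_loc (fun t => s *
    (/ sqrt (py (w t) * py (w t) + pz (w t) * pz (w t)) * py (w t)))).
  + revert Hnb; apply filter_imp; intros t <-; reflexivity.
  + now apply ex_derive_scal, ex_derive_mult.
- apply (ex_derive_ext_loc (fun t => s *
    (/ sqrt (py (w t) * py (w t) + pz (w t) * pz (w t)) * pz (w t)))).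
  + revert Hnb; apply filter_imp; intros t <-; reflexivity.
  + now apply ex_derive_scal, ex_derive_mult.
Qed.

(** * Constancy on intervals and resolution of the acceleration *)

Lemma open_Rbar_Ioo (a b : Rbar) : open (Rbar_Ioo a b).
Proof. apply open_and; [apply open_Rbar_gt | apply open_Rbar_lt]. Qed.

Lemma Rbar_Ioo_inhabited (a b : Rbar) :
  Rbar_lt a b -> exists x, Rbar_Ioo a b x.
Proof.
destruct a as [a| |], b as [b| |]; simpl; intros H; try easy.
- exists ((a + b) / 2); split; simpl; lra.
- exists (a + 1); split; simpl; [lra | easy].
- exists (b - 1); split; simpl; [easy | lra].
- now exists 0.
Qed.

(** The segment between two points stays in the interval, so the mean value theorem applies on
    it. *)
Lemma is_derive_0_constant_Ioo (a b : Rbar) (f : R -> R) :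
  (forall x, Rbar_Ioo a b x -> is_derive f x 0) ->
  forall x y, Rbar_Ioo a b x -> Rbar_Ioo a b y -> f x = f y.
Proof.
intros Hf x y Hx Hy.
assert (Hxy : forall z, Rmin x y <= z <= Rmax x y -> Rbar_Ioo a b z).
{ intros z [Hz1 Hz2]; split.
  - apply Rbar_lt_le_trans with (Rmin x y); [|exact Hz1].
    apply Rmin_case; [apply Hx | apply Hy].
  - apply Rbar_le_lt_trans with (Rmax x y); [exact Hz2|].
    apply Rmax_case; [apply Hx | apply Hy]. }
destruct (MVT_gen f x y (fun _ => 0)) as (c & _ & Hc).
- intros z Hz; apply Hf, Hxy; lra.
- intros z Hz. apply continuity_pt_filterlim, (ex_derive_continuous f).
  exists 0; now apply Hf, Hxy.
- lra.
Qed.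

(** Differentiating the unit relation makes the derivative vector orthogonal to [(f, g)]; by
    hypothesis it is also orthogonal to [(g, - f)], and these two span the plane. *)
Lemma is_derive_0_of_unit (f g : R -> R) (x : R) :
  locally x (fun t => f t * f t + g t * g t = 1) ->
  ex_derive f x -> ex_derive g x ->
  Derive f x * g x - Derive g x * f x = 0 ->
  is_derive f x 0 /\ is_derive g x 0.
Proof.
intros H1 Hf Hg H0.
pose proof (locally_singleton _ _ H1) as Hx; simpl in Hx.
assert (H : f x * Derive f x + g x * Derive g x = 0).
{ assert (E : Derive (fun t => f t * f t + g t * g t) x = 0).
  { etransitivity; [exact (Derive_ext_loc _ (fun _ => 1) x H1) | apply Derive_const]. }
  rewrite Derive_plus, !Derive_mult in E by
    (trivial; now apply ex_derive_mult).
  lra. }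
assert (Ef : Derive f x = 0).
(* First component of the derivative vector, expanded in that orthonormal basis. *)
{ transitivity (f x * (f x * Derive f x + g x * Derive g x)
    + g x * (Derive f x * g x - Derive g x * f x)).
  - transitivity (Derive f x * (f x * f x + g x * g x)); [rewrite Hx|]; ring.
  - rewrite H, H0; ring. }
assert (Eg : Derive g x = 0).
{ transitivity (g x * (f x * Derive f x + g x * Derive g x)
    - f x * (Derive f x * g x - Derive g x * f x)).
  - transitivity (Derive g x * (f x * f x + g x * g x)); [rewrite Hx|]; ring.
  - rewrite H, H0; ring. }
split; [rewrite <- Ef | rewrite <- Eg]; now apply Derive_correct.
Qed.

Lemma gdot_isotropic (v w : G3) :
  px v = 0 -> px w = 0 -> gdot v w = py v * py w + pz v * pz w.
Proof.
intros Hv Hw; unfold gdot.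
destruct (Req_EM_T (px v) 0); [|easy].
now destruct (Req_EM_T (px w) 0).
Qed.

Theorem theorem4p12 :
  forall (M : G3 -> Prop) (n : G3 -> G3) (a b : Rbar) (beta : R -> G3),
    oriented_surface M n ->
    Rbar_lt a b ->
    smooth_curve_on (Rbar_Ioo a b) beta ->
    unit_speed_on (Rbar_Ioo a b) beta ->
    (forall x : R, Rbar_Ioo a b x -> M (beta x)) ->
    line_of_curvature_on (Rbar_Ioo a b) n beta ->
    exists c1 c2 c3 c4 : R,
    exists Y1 Y Z1 Z : R -> R,
      antiderivative_on (Rbar_Ioo a b) Y1
        (fun x => c1 * geodesic_curvature n beta x
                  - c2 * normal_curvature n beta x) /\
      antiderivative_on (Rbar_Ioo a b) Y Y1 /\
      antiderivative_on (Rbar_Ioo a b) Z1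
        (fun x => c3 * geodesic_curvature n beta x
                  - c4 * normal_curvature n beta x) /\
      antiderivative_on (Rbar_Ioo a b) Z Z1 /\
      (forall x : R, Rbar_Ioo a b x -> beta x = (x, Y x, Z x)).
Proof.
intros M n a b beta HM Hab Hsm Hunit HMb Hline.
set (I := Rbar_Ioo a b) in *.
(* Identities on the open interval hold near each of its points, hence may be differentiated. *)
assert (Hloc : forall P : R -> Prop, (forall t, I t -> P t) ->
  forall x, I x -> locally x P).
{ intros P HP x Hx. exact (locally_open I P (open_Rbar_Ioo a b) HP x Hx). }
set (N2 := fun t => py (n (beta t))).
set (N3 := fun t => pz (n (beta t))).
assert (HN : forall x, I x -> px (n (beta x)) = 0 /\
                            N2 x * N2 x + N3 x * N3 x = 1).
{ intros x Hx; apply (oriented_normal_unit M); auto. }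
assert (HT : forall x, I x -> px (frame_T beta x) = 1).
{ intros x Hx; etransitivity; [|apply (Derive_id x)].
  exact (Derive_ext_loc _ (fun t => t) x (Hloc _ Hunit x Hx)). }
assert (HT' : forall x, I x -> px (vDerive (frame_T beta) x) = 0).
{ intros x Hx; etransitivity; [|apply (Derive_const 1 x)].
  exact (Derive_ext_loc _ (fun _ => 1) x (Hloc _ HT x Hx)). }
assert (HQ : forall x, I x -> frame_Q n beta x = (0, - N3 x, N2 x)).
{ intros x Hx; unfold frame_Q, gcross, frame_n.
  rewrite (proj1 (HN x Hx)), (HT x Hx); unfold N2, N3.
  f_equal; [f_equal|]; ring. }
assert (HdN : forall x, I x -> is_derive N2 x 0 /\ is_derive N3 x 0).
{ intros x Hx.
  destruct (ex_derive_normal_along M n beta x HM (Hloc _ HMb x Hx)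
    (proj1 (Hsm x Hx 1%nat)) (proj1 (proj2 (Hsm x Hx 1%nat)))
    (proj2 (proj2 (Hsm x Hx 1%nat)))) as [D2 D3].
  apply is_derive_0_of_unit; trivial.
  - apply (Hloc (fun t => N2 t * N2 t + N3 t * N3 t = 1)); trivial.
    intros t Ht; apply HN, Ht.
  (* With [Q = (0, - N3, N2)] the torsion is [N2' N3 - N3' N2], the expression that
     [is_derive_0_of_unit] wants to vanish. *)
  - generalize (Hline x Hx); unfold geodesic_torsion.
    assert (E : vDerive (frame_Q n beta) x
                = (0, - Derive N3 x, Derive N2 x)).
    { assert (ED : forall (g : G3 -> R) (h : R -> R),
        (forall t, I t -> g (0, - N3 t, N2 t) = h t) ->
        Derive (fun t => g (frame_Q n beta t)) x = Derive h x).
      { intros g h Hgh; apply Derive_ext_loc.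
        apply Hloc; trivial; intros t Ht; rewrite HQ; auto. }
      unfold vDerive.
      rewrite (ED px (fun _ => 0)), (ED py (fun t => - N3 t)), (ED pz N2)
        by reflexivity.
      now rewrite Derive_const, Derive_opp. }
    rewrite E, gdot_isotropic; [|reflexivity | apply HN, Hx].
    unfold py at 1, pz at 1, frame_n; simpl; fold (N2 x) (N3 x); lra. }
(* The constant values of [N2] and [N3] are read off at a base point. *)
destruct (Rbar_Ioo_inhabited a b Hab) as [x0 Hx0].
set (y := fun t => py (beta t)). set (z := fun t => pz (beta t)).
assert (Hk : forall x, I x ->
  - N3 x0 * geodesic_curvature n beta x - - N2 x0 * normal_curvature n beta x
    = Derive (Derive y) x /\
  N2 x0 * geodesic_curvature n beta x - - N3 x0 * normal_curvature n beta x
    = Derive (Derive z) x).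
{ intros x Hx.
  rewrite (is_derive_0_constant_Ioo a b N2 (fun t Ht => proj1 (HdN t Ht)) x0 x),
    (is_derive_0_constant_Ioo a b N3 (fun t Ht => proj2 (HdN t Ht)) x0 x)
    by trivial.
  unfold geodesic_curvature, normal_curvature, frame_n.
  assert (Q0 : px (frame_Q n beta x) = 0) by now rewrite HQ.
  rewrite (gdot_isotropic _ _ (HT' x Hx) Q0),
    (gdot_isotropic _ _ (HT' x Hx) (proj1 (HN x Hx))), (HQ x Hx).
  change (py (n (beta x))) with (N2 x); change (pz (n (beta x))) with (N3 x).
  change (py (?p, ?q, ?r)) with q; change (pz (?p, ?q, ?r)) with r.
  change (py (vDerive (frame_T beta) x)) with (Derive (Derive y) x).
  change (pz (vDerive (frame_T beta) x)) with (Derive (Derive z) x).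
  destruct (HN x Hx) as [_ H1].
  split.
  (* Once the curvatures are expanded, the mixed terms cancel and the unit relation remains as a
     factor. *)
  - transitivity (Derive (Derive y) x * (N2 x * N2 x + N3 x * N3 x));
      [|rewrite H1]; ring.
  - transitivity (Derive (Derive z) x * (N2 x * N2 x + N3 x * N3 x));
      [|rewrite H1]; ring. }
(* Coefficients of [Q] and [n] in the acceleration; [c2] and [c4] are negated because the formula
   subtracts the normal curvature terms. *)
exists (- N3 x0), (- N2 x0), (N2 x0), (- N3 x0).
exists (Derive y), y, (Derive z), z.
split; [|split; [|split; [|split]]]; intros x Hx.
- rewrite (proj1 (Hk x Hx)).
  (* Order 2 of [ex_derive_n] unfolds to differentiability of the first derivative. *)
  apply Derive_correct; exact (proj1 (proj2 (Hsm x Hx 2%nat))).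
- apply Derive_correct; exact (proj1 (proj2 (Hsm x Hx 1%nat))).
- rewrite (proj2 (Hk x Hx)).
  apply Derive_correct; exact (proj2 (proj2 (Hsm x Hx 2%nat))).
- apply Derive_correct; exact (proj2 (proj2 (Hsm x Hx 1%nat))).
- rewrite <- (Hunit x Hx) at 2; unfold y, z.
  now destruct (beta x) as [[p q] r].
Qed.
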